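(* Let $n \geq 5$ be an odd integer. (i) Player $A$ has a winning strategy in the game $Z(n,d)$ for every $d \in \{2,3\}$. (ii) If moreover $n \geq 11$, then Player $A$ has a winning strategy in the game $Z(n,d)$ for every $d \in \{2,3,4,5,6\}$.
   Context: For integers $n \geq 4$ and $d \geq 2$, $Z(n,d)$ is the following two-player game. Initially the board contains the numbers $1,2,\dots,n$. Players $A$ and $B$ alternately cross out (remove) one number from the board, with $A$ moving first, until exactly two numbers remain. If the sum of the two remaining numbers is divisible by $d$, $A$ wins; otherwise $B$ wins. A player has a winning strategy if that player can force a win regardless of the opponent's moves. *)

(* Defs.v *)
From mathcomp Require Import all_boot.

Set Implicit Arguments.
Unset Strict Implicit.
Unset Printing Implicit Defensive.

Inductive player := PlayerA | PlayerB.

(* The numbers crossed out so far in the game Z(n,d), in chronological order. *)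
Definition history := seq nat.

Definition board (n : nat) (h : history) : seq nat :=
  [seq x <- iota 1 n | x \notin h].

Definition turn (h : history) : player :=
  if odd (size h) then PlayerB else PlayerA.

Definition legal_move (n : nat) (h : history) (x : nat) : Prop :=
  2 < size (board n h) /\ x \in board n h.

Definition legal_history (n : nat) (h : history) : Prop :=
  forall i, i < size h -> legal_move n (take i h) (nth 0 h i).

Definition complete_play (n : nat) (h : history) : Prop :=
  legal_history n h /\ size (board n h) = 2.

Definition winner (n d : nat) (h : history) : player :=
  if d %| sumn (board n h) then PlayerA else PlayerB.

Definition is_strategy (p : player) (n : nat) (s : history -> nat) : Prop :=
  forall h, legal_history n h -> 2 < size (board n h) -> turn h = p ->
    legal_move n h (s h).

Definition follows (p : player) (s : history -> nat) (h : history) : Prop :=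
  forall i, i < size h -> turn (take i h) = p -> nth 0 h i = s (take i h).

Definition has_winning_strategy (p : player) (n d : nat) : Prop :=
  exists s : history -> nat,
    is_strategy p n s /\
    forall h, complete_play n h -> follows p s h -> winner n d h = p.

(* Main.v *)
Require Import Defs.
From mathcomp Require Import all_boot.
From mathcomp Require Import zify.
From Stdlib Require Import ClassicalEpsilon.

Set Implicit Arguments.
Unset Strict Implicit.
Unset Printing Implicit Defensive.

(** For odd [n] player B always faces an even number of numbers, so A wins as
    soon as those numbers can be split into pairs with sum divisible by [d]:
    whenever B crosses out a number, A crosses out its partner.  A also wins
    from such a paired set enlarged by four numbers [u, a, b, c] where [a, b, c]
    are pairwise complementary: as soon as B takes one of the four, A takes
    another one so that two of [a, b, c] survive, and B must do this eventually.
    Since any [2 * d] consecutive numbers can be paired, a good first move in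
    [Z(n,d)] is also good in [Z(n + 2 * d,d)], which leaves finitely many [n]. *)

Inductive matched (d : nat) : seq nat -> Prop :=
| matched_nil : matched d [::]
| matched_pair x y s t :
    d %| x + y -> matched d s -> perm_eq t [:: x, y & s] -> matched d t.

Definition safe (d : nat) (s : seq nat) : Prop :=
  matched d s \/
  exists u a b c t, [/\ perm_eq s [:: u, a, b, c & t], matched d t,
    d %| a + b, d %| b + c & d %| a + c].

Definition safe_opening (d n : nat) : Prop :=
  exists y t, perm_eq (iota 1 n) (y :: t) /\ safe d t.

(** * Closure properties of matched and safe sets *)

Lemma perm_matched d s t : perm_eq s t -> matched d s -> matched d t.
Proof.
move=> + ms; case: ms => [|x y s' t' xy ms' t'E] st.
  by move: st; rewrite perm_sym => /perm_nilP ->; exact: matched_nil.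
by apply: matched_pair xy ms' _; rewrite -(permPl st).
Qed.

Lemma perm_safe d s t : perm_eq s t -> safe d s -> safe d t.
Proof.
move=> st [ms|[u [a [b [c [s' [sE ms' ab bc ac]]]]]]].
  by left; exact: perm_matched st ms.
by right; exists u, a, b, c, s'; split=> //; rewrite -(permPl st).
Qed.

Lemma matched_cat d s t : matched d s -> matched d t -> matched d (s ++ t).
Proof.
move=> ms mt; elim: ms => // x y s' s'' xy _ IH s''E.
by apply: matched_pair xy IH _; rewrite -[_ :: _]/([:: x, y & s'] ++ t) perm_cat2r.
Qed.

Lemma safe_cat d s t : safe d s -> matched d t -> safe d (s ++ t).
Proof.
case=> [ms|[u [a [b [c [s' [sE ms' ab bc ac]]]]]]] mt.
  by left; exact: matched_cat.
right; exists u, a, b, c, (s' ++ t); split=> //; last exact: matched_cat.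
by rewrite -[X in perm_eq _ X]/([:: u, a, b, c & s'] ++ t) perm_cat2r.
Qed.

Lemma matched_partner d s x : matched d s -> x \in s ->
  exists y t, [/\ perm_eq s [:: x, y & t], d %| x + y & matched d t].
Proof.
move=> ms; elim: ms x => // a b s' s'' ab ms' IH s''E x.
rewrite (perm_mem s''E) !inE.
case/or3P => [/eqP->|/eqP->|xs'].
- by exists b, s'.
- exists a, s'; split=> //; last by rewrite addnC.
  by rewrite (permPl s''E) (perm_catCA [:: a] [:: b] s').
- have [y [t [s'E xy mt]]] := IH x xs'.
  exists y, [:: a, b & t]; split=> //; last exact: matched_pair ab mt _.
  rewrite (permPl s''E) perm_sym (perm_catCA [:: x; y] [:: a; b] t).
  by rewrite !perm_cons perm_sym.
Qed.

(** Divisibility of a pair sum depends only on residues modulo [d], so the partner of [x] also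
    serves [y]. *)
Lemma matched_congr d x y s :
  x = y %[mod d] -> matched d (x :: s) -> matched d (y :: s).
Proof.
move=> xy mxs.
have [z [t [sE xz mt]]] := matched_partner mxs (mem_head x s).
apply: (@matched_pair _ y z t _ _ mt); last by move: sE; rewrite !perm_cons.
by rewrite /dvdn -modnDml -xy modnDml.
Qed.

(** Sliding the window by one step trades its least entry for one larger by [2 * d], hence congruent
    modulo [d]. *)
Lemma matched_shift d m :
  matched d (iota 1 (2 * d)) -> matched d (iota m.+1 (2 * d)).
Proof.
move=> m1; elim: m => // m; case: d m1 => [|d] m1 //.
rewrite mul2n doubleS => IH.
apply: (perm_matched (s := (m.+1 + d.+1.*2) :: iota m.+2 d.*2.+1)).
  rewrite -[d.*2.+2]addn1 iotaD cats1 perm_sym perm_rcons.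
  by rewrite doubleS addSnnS.
by apply: matched_congr IH; rewrite -mul2n addnC modnMDl.
Qed.

Lemma safe_reply d s x : safe d s -> x \in s ->
  exists y t, perm_eq s [:: x, y & t] /\ safe d t.
Proof.
case=> [ms xs|[u [a [b [c [s' [sE ms' ab bc ac]]]]]]].
  by have [y [t [sE _ mt]]] := matched_partner ms xs; exists y, t; split=> //; left.
rewrite (perm_mem sE) !inE.
have swap (v w : nat) t : perm_eq [:: v, w & t] [:: w, v & t].
  by rewrite (perm_catCA [:: v] [:: w] t).
case: (boolP (x \in s')) => [xs' _|_ /[!orbF]].
  have [y [t [s'E _ mt]]] := matched_partner ms' xs'.
  exists y, [:: u, a, b, c & t]; split; last by right; exists u, a, b, c, t.
  rewrite (permPl sE) perm_sym (perm_catCA [:: x; y] [:: u; a; b; c] t).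
  by rewrite !perm_cons perm_sym.
(* The reply to [u] is [a], and the reply to [a], [b] or [c] is [u]; either way two of the triple
   survive and become an ordinary pair. *)
case/or4P => /eqP->.
- exists a, [:: b, c & s']; split=> //; left; exact: matched_pair bc ms' _.
- exists u, [:: b, c & s']; split; last by left; exact: matched_pair bc ms' _.
  by rewrite (permPl sE); exact: swap.
- exists u, [:: a, c & s']; split; last by left; exact: matched_pair ac ms' _.
  rewrite (permPl sE) (permPr (swap _ _ _)) perm_cons; exact: swap.
- exists u, [:: a, b & s']; split; last by left; exact: matched_pair ab ms' _.
  rewrite (permPl sE) (permPr (swap _ _ _)) perm_cons.
  by rewrite perm_sym (perm_catCA [:: c] [:: a; b] s').
Qed.

(** Two numbers leave no room for the four extra ones, so they form a single pair. *)
Lemma safe_dvd_sum d s : safe d s -> size s = 2 -> d %| sumn s.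
Proof.
case=> [ms|[u [a [b [c [t [/perm_size -> _ _ _ _]]]]]] //].
case: ms => // x y t s' xy _ s'E /eqP.
rewrite (perm_size s'E) (perm_sumn s'E) /= !eqSS size_eq0 => /eqP->.
by rewrite /= addn0.
Qed.

(** * Histories, boards and the strategy of A *)

Lemma perm_board_rcons n h x : x \in board n h ->
  perm_eq (board n h) (x :: board n (rcons h x)).
Proof.
move=> xb; rewrite (permPl (perm_to_rem xb)) perm_cons.
rewrite rem_filter ?filter_uniq ?iota_uniq // /board -filter_predI.
rewrite (@eq_filter _ _ (fun y => y \notin rcons h x)) // => y.
by rewrite /= mem_rcons inE negb_or.
Qed.

Lemma legal_history_rcons n h x :
  legal_history n (rcons h x) -> legal_history n h /\ legal_move n h x.
Proof.
move=> lhx; split=> [i ih|].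
  have := lhx i; rewrite size_rcons => /(_ (leqW ih)).
  by rewrite nth_rcons ih -cats1 takel_cat // ltnW.
have := lhx (size h); rewrite size_rcons => /(_ (leqnn _)).
by rewrite nth_rcons ltnn eqxx -cats1 take_size_cat.
Qed.

Lemma follows_rcons p s h x : follows p s (rcons h x) ->
  follows p s h /\ (turn h = p -> x = s h).
Proof.
move=> fhx; split=> [i ih|].
  have := fhx i; rewrite size_rcons => /(_ (leqW ih)).
  by rewrite nth_rcons ih -cats1 takel_cat // ltnW.
have := fhx (size h); rewrite size_rcons => /(_ (leqnn _)).
by rewrite nth_rcons ltnn eqxx -cats1 take_size_cat.
Qed.

Lemma size_board n h : legal_history n h -> size (board n h) + size h = n.
Proof.
elim/last_ind: h => [|h x IH].
  by rewrite addn0 /board (eq_filter (a2 := predT)) // filter_predT size_iota.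
case/legal_history_rcons => lh [_ xb].
by rewrite -[RHS](IH lh) (perm_size (perm_board_rcons xb)) size_rcons /= addnS.
Qed.

Lemma safe_opening_wins n d :
  odd n -> 2 < n -> safe_opening d n -> has_winning_strategy PlayerA n d.
Proof.
move=> on n2 [y0 [t0 [y0E safe0]]].
(* A [good] move leaves a safe board. When none exists, [best] accepts any number on the board,
   because a strategy must move legally even after histories it would never produce. *)
pose good h y := y \in board n h /\ safe d (board n (rcons h y)).
pose best h y := y \in board n h /\ ((exists z, good h z) -> good h y).
pose s h := epsilon (inhabits 0) (best h).
have sP h : 2 < size (board n h) -> best h (s h).
  move=> sz; apply: epsilon_spec.
  have [[z gz]|ng] := classic (exists z, good h z).
    by exists z; split=> //; case: gz.
  by case E: (board n h) sz => [|y b] // _; exists y; split=> //; rewrite E mem_head.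
exists s; split=> [h _ sz _|h [lh szh] fh]; first by split=> //; case: (sP h sz).
(* Invariant along plays that follow [s]: B always faces a safe board, and A always has a good
   move. *)
have inv g : legal_history n g -> follows PlayerA s g ->
    if odd (size g) then safe d (board n g) else exists y, good g y.
  elim/last_ind: g => [|g x IH].
    move=> _ _ /=; exists y0.
    have bE : board n [::] = iota 1 n.
      by rewrite /board (eq_filter (a2 := predT)) // filter_predT.
    have y0b : y0 \in board n [::] by rewrite bE (perm_mem y0E) mem_head.
    split=> //; apply: perm_safe safe0.
    by have := perm_board_rcons y0b; rewrite bE (permPl y0E) perm_cons.
  case/legal_history_rcons => lg [sz xb] /follows_rcons[fg xE].
  have := IH lg fg; rewrite size_rcons /=.
  case: ifPn => [og safeg|eg gg]; last first.
    by rewrite xE; [have [_ /(_ gg)[]] := sP g sz | rewrite /turn (negbTE eg)].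
  have [y [t [gE st]]] := safe_reply safeg xb.
  have tE : perm_eq (board n (rcons g x)) (y :: t).
    by have := perm_board_rcons xb; rewrite (permPl gE) perm_cons perm_sym.
  have yb : y \in board n (rcons g x) by rewrite (perm_mem tE) mem_head.
  exists y; split=> //; apply: perm_safe st.
  by have := perm_board_rcons yb; rewrite (permPl tE) perm_cons.
(* Two numbers remain, so [n - 2] moves were made; this is odd, and the safe branch of the invariant
   applies. *)
have oh : odd (size h) by have := size_board lh; lia.
by have := inv h lh fh; rewrite oh /winner => /safe_dvd_sum ->.
Qed.

(** * Certificates checked by computation *)

(** The fuel [k] is there because [rem y t] is not a structural subterm. The chosen [y] is tested
    again, so a failed search, where [nth] returns [0], cannot yield a false pairing. *)
Fixpoint greedy_matched (d k : nat) (s : seq nat) : bool :=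
  match k, s with
  | _, [::] => true
  | 0, _ => false
  | k'.+1, x :: t =>
      let y := nth 0 t (find (fun y => d %| x + y) t) in
      [&& y \in t, d %| x + y & greedy_matched d k' (rem y t)]
  end.

Lemma greedy_matchedP d k s : greedy_matched d k s -> matched d s.
Proof.
elim: k s => [|k IH] [|x t] //=; try by move=> _; exact: matched_nil.
case/and3P; set y := nth _ _ _ => yt xy /IH mt.
by apply: matched_pair xy mt _; rewrite perm_cons; exact: perm_to_rem.
Qed.

Lemma safe_opening_matched d n y :
  (let t := rem y (iota 1 n) in
   (y \in iota 1 n) && greedy_matched d n t) ->
  safe_opening d n.
Proof.
case/andP=> yn /greedy_matchedP mt; exists y, (rem y (iota 1 n)).
by split; [exact: perm_to_rem | left].
Qed.

(** Meant for boards where three residue classes up to sign cannot be paired off internally, so that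
    one removal does not suffice: [y] and [u] balance two of them, and [a], [b], [c] come from the
    third. *)
Lemma safe_opening_triple d n y u a b c :
  (let q := [:: y; u; a; b; c] in
   let t := [seq x <- iota 1 n | x \notin q] in
   [&& perm_eq (iota 1 n) (q ++ t), greedy_matched d n t,
       d %| a + b, d %| b + c & d %| a + c]) ->
  safe_opening d n.
Proof.
case/and5P=> nE /greedy_matchedP mt ab bc ac.
by exists y; eexists; split; [exact: nE | right; exists u, a, b, c; eexists].
Qed.

Lemma safe_opening_periodic d m : 0 < d -> matched d (iota 1 (2 * d)) ->
  (forall b, odd b -> m <= b < m + 2 * d -> safe_opening d b) ->
  forall n, odd n -> m <= n -> safe_opening d n.
Proof.
move=> d0 md base; elim/ltn_ind => n IH on mn.
have [small|large] := ltnP n (m + 2 * d); first by apply: base => //; rewrite mn.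
(* Subtracting [2 * d] preserves oddness, and [d0] makes the result smaller than [n]. *)
have [] := IH (n - 2 * d); try lia.
move=> y [t [tE st]]; exists y, (t ++ iota (n - 2 * d).+1 (2 * d)); split.
  rewrite -[X in iota 1 X](subnK (n := n) (m := 2 * d)); last lia.
  by rewrite iotaD add1n -cat_cons perm_cat2r.
exact: safe_cat st (matched_shift _ md).
Qed.

(** * Explicit first moves over one period *)

Lemma safe_opening_small d n :
  odd n -> 5 <= n -> d \in [:: 2; 3] -> safe_opening d n.
Proof.
move=> on n5; rewrite !inE => /orP[] /eqP->.
- apply: (@safe_opening_periodic 2 5) => // [|b ob rb].
    by apply: (@greedy_matchedP _ 4).
  have : b \in [:: 5; 7] by rewrite !inE; lia.
  rewrite !inE => /orP[] /eqP->.
  + by apply: (@safe_opening_matched _ _ 1).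
  + by apply: (@safe_opening_matched _ _ 2).
- apply: (@safe_opening_periodic 3 5) => // [|b ob rb].
    by apply: (@greedy_matchedP _ 6).
  have : b \in [:: 5; 7; 9] by rewrite !inE; lia.
  rewrite !inE => /or3P[] /eqP->.
  + by apply: (@safe_opening_matched _ _ 3).
  + by apply: (@safe_opening_matched _ _ 1).
  + by apply: (@safe_opening_matched _ _ 3).
Qed.

Lemma safe_opening_large d n :
  odd n -> 11 <= n -> d \in [:: 4; 5; 6] -> safe_opening d n.
Proof.
move=> on n11; rewrite !inE => /or3P[] /eqP->.
- apply: (@safe_opening_periodic 4 11) => // [|b ob rb].
    by apply: (@greedy_matchedP _ 8).
  have : b \in [:: 11; 13; 15; 17] by rewrite !inE; lia.
  rewrite !inE => /or4P[] /eqP->.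
  + by apply: (@safe_opening_matched _ _ 2).
  (* Among [1, ..., 13] there are three multiples of 4 and three numbers congruent to 2; both counts
     are odd, so no single removal leaves a matched set. *)
  + by apply: (@safe_opening_triple _ _ 1 2 4 8 12).
  + by apply: (@safe_opening_matched _ _ 4).
  + by apply: (@safe_opening_matched _ _ 1).
- apply: (@safe_opening_periodic 5 11) => // [|b ob rb].
    by apply: (@greedy_matchedP _ 10).
  have : b \in [:: 11; 13; 15; 17; 19] by rewrite !inE; lia.
  rewrite !inE => /orP[/eqP->|/or4P[] /eqP->].
  + by apply: (@safe_opening_matched _ _ 1).
  + by apply: (@safe_opening_matched _ _ 1).
  + by apply: (@safe_opening_matched _ _ 5).
  + by apply: (@safe_opening_triple _ _ 1 2 5 10 15).
  + by apply: (@safe_opening_matched _ _ 5).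
- apply: (@safe_opening_periodic 6 11) => // [|b ob rb].
    by apply: (@greedy_matchedP _ 12).
  have : b \in [:: 11; 13; 15; 17; 19; 21] by rewrite !inE; lia.
  rewrite !inE => /or3P[/eqP->|/eqP->|/or4P[] /eqP->].
  + by apply: (@safe_opening_matched _ _ 6).
  + by apply: (@safe_opening_matched _ _ 1).
  (* Here the triple is congruent to 3, half the modulus, rather than to 0. *)
  + by apply: (@safe_opening_triple _ _ 1 2 3 9 15).
  + by apply: (@safe_opening_matched _ _ 3).
  + by apply: (@safe_opening_triple _ _ 1 3 6 12 18).
  + by apply: (@safe_opening_triple _ _ 1 2 6 12 18).
Qed.

Theorem theorem3p1p8 (n : nat) (hn : 5 <= n) (hodd : odd n) :
  (forall d : nat, d \in [:: 2; 3] -> has_winning_strategy PlayerA n d) /\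
  (11 <= n ->
   forall d : nat, d \in [:: 2; 3; 4; 5; 6] ->
     has_winning_strategy PlayerA n d).
Proof.
have n2 : 2 < n by exact: leq_trans hn.
split=> [d d23|n11 d].
  exact: safe_opening_wins hodd n2 (safe_opening_small hodd hn d23).
rewrite -[[:: 2; 3; 4; 5; 6]]/([:: 2; 3] ++ [:: 4; 5; 6]) mem_cat.
case/orP=> dE; apply: (safe_opening_wins hodd n2).
  exact: safe_opening_small hodd hn dE.
exact: safe_opening_large hodd n11 dE.
Qed.
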